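(* Let $\varepsilon\in(0,1)$. There is $\eta=\widetilde O(\varepsilon^2/(d_Ad_C)^2)$, $\eta\in(0,1)$, such that with $\nu = \varepsilon/(8\log(d_Ad_C/\eta^2))$, conditional mutual information testing with threshold $\varepsilon$ can be solved by preprocessing each sample $(a,b,c)$ of $P_{ABC}$ as follows — independently with probability $\eta$ replace $a$ by a uniformly random element of $[d_A]$, and independently with probability $\eta$ replace $c$ by a uniformly random element of $[d_C]$ — and then applying any tester for conditional independence testing in squared Hellinger distance with threshold $\nu$ to the preprocessed samples. In particular, $$\textnormal{SC}_{\textnormal{CMI}}(\varepsilon, d_A, d_B, d_C) \leq O\left(\textnormal{SC}_{\textnormal{CI},H}(\nu, d_A, d_B, d_C)\right),$$ and analogously $\textnormal{SC}_{\textnormal{MI}}(\varepsilon, d_A, d_C) \leq O(\textnormal{SC}_{\textnormal{I},H}(\nu, d_A, d_C))$.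
   Context: Distributions are on $[d_A]\times[d_B]\times[d_C]$ (or $[d_A]\times[d_C]$). KL divergence $D(P\|Q)=\sum_xP(x)\log\frac{P(x)}{Q(x)}$; squared Hellinger distance $D_H^2(P,Q)=\frac12\sum_x(\sqrt{P(x)}-\sqrt{Q(x)})^2$. $I(A:C|B)_P=D(P_{ABC}\|P_{AB}P_{C|B})$, $I(A:C)_P=D(P_{AC}\|P_AP_C)$. A tester gets $N$ i.i.d. samples and must be correct with probability $\geq 2/3$ on both classes (any output otherwise). $\textnormal{SC}_{\textnormal{CMI}}(\varepsilon,d_A,d_B,d_C)$: minimal $N$ to distinguish $I(A:C|B)_P=0$ from $I(A:C|B)_P\geq\varepsilon$. $\textnormal{SC}_{\textnormal{MI}}(\varepsilon,d_A,d_C)$: minimal $N$ to distinguish $I(A:C)_P=0$ from $I(A:C)_P\geq\varepsilon$. $\textnormal{SC}_{\textnormal{CI},H}(\nu,d_A,d_B,d_C)$: minimal $N$ to distinguish $D_H^2(P_{ABC},P_{AB}P_{C|B})=0$ from $D_H^2(P_{ABC},P_{AB}P_{C|B})\geq\nu$. $\textnormal{SC}_{\textnormal{I},H}(\nu,d_A,d_C)$: minimal $N$ to distinguish $D_H^2(P_{AC},P_AP_C)=0$ from $\geq\nu$. $\widetilde O$ hides poly-logarithmic factors. *)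

(* Defs.v *)
From HB Require Import structures.
From mathcomp Require Import all_boot all_order all_algebra.
From mathcomp Require Import all_classical all_reals all_analysis.
Set Implicit Arguments.
Unset Strict Implicit.
Unset Printing Implicit Defensive.
Import Order.TTheory GRing.Theory Num.Theory.
Local Open Scope classical_set_scope.
Local Open Scope ring_scope.

Definition is_dist (R : realType) (X : finType) (P : X -> R) : Prop :=
  (forall x, 0 <= P x) /\ \sum_x P x = 1.

(* Convention: 0 log (0 / q) = 0 for all q, and p log (p / 0) = +oo if p <> 0. *)
Definition kl (R : realType) (X : finType) (P Q : X -> R) : \bar R :=
  (\sum_x (if P x == 0%R then 0
           else if Q x == 0%R then +oo
           else (P x * ln (P x / Q x))%:E))%E.

Definition hellinger2 (R : realType) (X : finType) (P Q : X -> R) : R :=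
  2^-1 * \sum_x (Num.sqrt (P x) - Num.sqrt (Q x)) ^+ 2.

Definition fst_marginal (R : realType) (X Y : finType) (P : X * Y -> R)
  (x : X) : R := \sum_y P (x, y).

Definition snd_marginal (R : realType) (X Y : finType) (P : X * Y -> R)
  (y : Y) : R := \sum_x P (x, y).

Definition indep_product (R : realType) (A C : finType) (P : A * C -> R)
  (x : A * C) : R := fst_marginal P x.1 * snd_marginal P x.2.

Definition marginal_BC (R : realType) (A B C : finType) (P : A * B * C -> R)
  (x : B * C) : R := \sum_a P (a, x.1, x.2).

(* P_{C|B}; it is 0 where P_B vanishes, since division by 0 yields 0. *)
Definition cond_C_B (R : realType) (A B C : finType) (P : A * B * C -> R)
  (b : B) (c : C) : R :=
  marginal_BC P (b, c) / fst_marginal (marginal_BC P) b.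

(* P_AB P_{C|B}; the value chosen for P_{C|B} where P_B = 0 is irrelevant,
   as P_AB vanishes there. *)
Definition markov_product (R : realType) (A B C : finType)
  (P : A * B * C -> R) (x : A * B * C) : R :=
  fst_marginal P x.1 * cond_C_B P x.1.2 x.2.

Definition mutual_info (R : realType) (A C : finType) (P : A * C -> R)
  : \bar R := kl P (indep_product P).

Definition cond_mutual_info (R : realType) (A B C : finType)
  (P : A * B * C -> R) : \bar R := kl P (markov_product P).

Definition is_kernel (R : realType) (X : Type) (Y : finType)
  (K : X -> Y -> R) : Prop := forall x, is_dist (K x).

Definition kernel_comp (R : realType) (X : Type) (Y : finType) (Z : Type)
  (K : X -> Y -> R) (L : Y -> Z -> R) (x : X) (z : Z) : R :=
  \sum_y K x y * L y z.

(* K applied independently to each of the N coordinates *)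
Definition kernel_tensor (R : realType) (X Y : finType) (N : nat)
  (K : X -> Y -> R) (s : N.-tuple X) (t : N.-tuple Y) : R :=
  \prod_(i < N) K (tnth s i) (tnth t i).

Definition iid (R : realType) (X : finType) (N : nat) (P : X -> R)
  (s : N.-tuple X) : R := \prod_(i < N) P (tnth s i).

(* A (possibly randomized) tester is a Markov kernel T from N-tuples of samples
   to bool: T s b is the probability of answering b on the samples s. *)
Definition output_prob (R : realType) (X : finType) (N : nat) (P : X -> R)
  (T : N.-tuple X -> bool -> R) (b : bool) : R :=
  \sum_(s : N.-tuple X) iid P s * T s b.

(* T answers [true] on the class H0 and [false] on the class H1, each with
   probability at least 2/3; nothing is required outside H0 and H1. *)
Definition distinguishes (R : realType) (X : finType) (N : nat)
  (H0 H1 : (X -> R) -> Prop) (T : N.-tuple X -> bool -> R) : Prop :=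
  [/\ is_kernel T,
      forall P, is_dist P -> H0 P -> 2 / 3 <= output_prob P T true
    & forall P, is_dist P -> H1 P -> 2 / 3 <= output_prob P T false].

(* The minimal number of samples for which a tester satisfying [solves] exists,
   +oo if there is none. *)
Definition sample_complexity (R : realType) (X : finType)
  (solves : forall N : nat, (N.-tuple X -> bool -> R) -> Prop) : \bar R :=
  ereal_inf [set (N%:R : R)%:E | N in
    [set N : nat | exists T : N.-tuple X -> bool -> R, solves N T]].

Definition cmi_tester (R : realType) (A B C : finType) (eps : R) (N : nat)
  (T : N.-tuple (A * B * C)%type -> bool -> R) : Prop :=
  distinguishes (fun P => cond_mutual_info P = 0%E)
                (fun P => (eps%:E <= cond_mutual_info P)%E) T.

Definition mi_tester (R : realType) (A C : finType) (eps : R) (N : nat)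
  (T : N.-tuple (A * C)%type -> bool -> R) : Prop :=
  distinguishes (fun P => mutual_info P = 0%E)
                (fun P => (eps%:E <= mutual_info P)%E) T.

Definition ci_hellinger_tester (R : realType) (A B C : finType) (nu : R) (N : nat)
  (T : N.-tuple (A * B * C)%type -> bool -> R) : Prop :=
  distinguishes (fun P => hellinger2 P (markov_product P) = 0)
                (fun P => nu <= hellinger2 P (markov_product P)) T.

Definition i_hellinger_tester (R : realType) (A C : finType) (nu : R) (N : nat)
  (T : N.-tuple (A * C)%type -> bool -> R) : Prop :=
  distinguishes (fun P => hellinger2 P (indep_product P) = 0)
                (fun P => nu <= hellinger2 P (indep_product P)) T.

Definition SC_CMI (R : realType) (eps : R) (dA dB dC : nat) : \bar R :=
  sample_complexity
    (fun N (T : N.-tuple ('I_dA * 'I_dB * 'I_dC)%type -> bool -> R) =>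
       cmi_tester eps T).

Definition SC_MI (R : realType) (eps : R) (dA dC : nat) : \bar R :=
  sample_complexity
    (fun N (T : N.-tuple ('I_dA * 'I_dC)%type -> bool -> R) =>
       mi_tester eps T).

Definition SC_CI_H (R : realType) (nu : R) (dA dB dC : nat) : \bar R :=
  sample_complexity
    (fun N (T : N.-tuple ('I_dA * 'I_dB * 'I_dC)%type -> bool -> R) =>
       ci_hellinger_tester nu T).

Definition SC_I_H (R : realType) (nu : R) (dA dC : nat) : \bar R :=
  sample_complexity
    (fun N (T : N.-tuple ('I_dA * 'I_dC)%type -> bool -> R) =>
       i_hellinger_tester nu T).

(* With probability eta, replace x by a uniformly random element of X. *)
Definition replace_unif (R : realType) (eta : R) (X : finType) (x y : X) : R :=
  (1 - eta) * (y == x)%:R + eta * (#|X|%:R)^-1.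

(* Independent replacement of a and c in a sample (a, b, c); b is kept. *)
Definition noise_kernel (R : realType) (eta : R) (A B C : finType)
  (x y : A * B * C) : R :=
  replace_unif eta x.1.1 y.1.1 * (y.1.2 == x.1.2)%:R * replace_unif eta x.2 y.2.

Definition preprocessed (R : realType) (eta : R) (A B C : finType) (N : nat)
  (T : N.-tuple (A * B * C)%type -> bool -> R)
  : N.-tuple (A * B * C)%type -> bool -> R :=
  kernel_comp (kernel_tensor (@noise_kernel R eta A B C)) T.

(* f = g up to factors polylogarithmic in dA dC / eps, in both directions: an
   upper bound alone would allow f to be arbitrarily small. *)
Definition eq_up_to_polylog (R : realType) (f g : R -> nat -> nat -> R) : Prop :=
  exists (K : R) (k : nat), 0 < K /\
    forall (eps : R) (dA dC : nat), 0 < eps < 1 -> (0 < dA)%N -> (0 < dC)%N ->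
      let L := (1 + ln ((dA * dC)%:R / eps)) ^+ k in
      f eps dA dC <= K * L * g eps dA dC /\ g eps dA dC <= K * L * f eps dA dC.

(* Main.v *)
(* Decompose P over b: both I(A:C|B) and D_H^2(P_ABC, P_AB P_{C|B}) are the
   averages over b of the corresponding quantities for the slices P(.|b) on A x C,
   and the noise acts on each slice separately; so everything reduces to one
   distribution p on A x C and its noisy version p'.
   - The noise pushes p_A x p_C to p'_A x p'_C, so independence is preserved.
   - It moves every entry of p, p_A and p_C by at most 2 eta.  Since
     |x ln x - y ln y| <= 2 sqrt |x - y| on [0, 1], writing I(A:C) with entropies
     shows a loss of at most 8 dA dC sqrt eta, which is eps / 2 for
     eta = (eps / (16 dA dC))^2.
   - The likelihood ratio p' / (p'_A x p'_C) is at most M = dA dC / eta^2, and a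
     bounded ratio gives D <= 4 ln M D_H^2. *)
Require Import Defs.
From HB Require Import structures.
From mathcomp Require Import all_boot all_order all_algebra.
From mathcomp Require Import all_classical all_reals all_analysis.
From mathcomp Require Import ring lra.
Set Implicit Arguments.
Unset Strict Implicit.
Unset Printing Implicit Defensive.
Import Order.TTheory GRing.Theory Num.Theory.
Local Open Scope ring_scope.

(** * Scalar inequalities for [ln], x ln x and single divergence terms *)

Lemma ln_leB1 (R : realType) (x : R) : 0 < x -> ln x <= x - 1.
Proof.
move=> x0; have := @le_ln1Dx R (x - 1); rewrite addrCA subrr addr0; apply.
by lra.
Qed.

Lemma ln_ge1BV (R : realType) (x : R) : 0 < x -> 1 - x^-1 <= ln x.
Proof.
move=> x0; have := @ln_leB1 R x^-1; rewrite invr_gt0 lnV ?posrE// => /(_ x0).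
by lra.
Qed.

(** With s = sqrt x, x ln x = 2 s^2 ln s >= 2 s^2 (1 - 1/s) = 2 s^2 - 2 s. *)
Lemma mulr_ln_ge (R : realType) (x : R) : 0 <= x -> - (2 * Num.sqrt x) <= x * ln x.
Proof.
move=> x0; have [->|xN0] := eqVneq x 0; first by rewrite sqrtr0 mul0r mulr0 oppr0.
have s0 : 0 < Num.sqrt x by rewrite sqrtr_gt0 lt_def xN0.
rewrite -{2 3}(sqr_sqrtr x0); set s := Num.sqrt x in s0 *.
rewrite lnXn// mulr2n.
have h := ln_ge1BV s0.
have : s ^+ 2 * (1 - s^-1) <= s ^+ 2 * ln s by rewrite ler_wpM2l// sqr_ge0.
have -> : s ^+ 2 * (1 - s^-1) = s ^+ 2 - s by field; rewrite gt_eqF.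
have := sqr_ge0 s; lra.
Qed.

(** For 0 < x <= y, split y ln y - x ln x = x (ln y - ln x) + (y - x) ln y. The first summand lies
    in [0, y - x], and y - x <= sqrt (y - x). The second is nonpositive and at least (y - x) ln (y -
    x) >= - 2 sqrt (y - x). *)
Lemma mulr_ln_dist (R : realType) (x y : R) : 0 <= x <= 1 -> 0 <= y <= 1 ->
  `|x * ln x - y * ln y| <= 2 * Num.sqrt `|x - y|.
Proof.
wlog xy : x y / x <= y.
  move=> h hx hy; have [xy|/ltW xy] := leP x y; first exact: h.
  by rewrite distrC (distrC x); exact: h.
move=> /andP[x0 x1] /andP[y0 y1].
rewrite distrC (distrC x) (@ger0_norm _ (y - x)) ?subr_ge0//.
have [->|xN0] := eqVneq x 0.
  have := mulr_ln_ge y0; have : ln y <= 0 by exact: ln_le0.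
  rewrite mul0r !subr0 => hy h; rewrite ler0_norm; [lra | nra].
have {}x0 : 0 < x by rewrite lt_def xN0.
have {}y0 : 0 < y by lra.
have d0 : 0 <= y - x by lra.
have dy1 : y - x <= 1 by lra.
have ds : y - x <= Num.sqrt (y - x).
  have s1 : Num.sqrt (y - x) <= 1 by rewrite -(sqrtr1 R) ler_sqrt.
  by have := sqr_sqrtr d0; have := sqrtr_ge0 (y - x); nra.
have lnx : x * (ln y - ln x) <= y - x.
  have := @ln_leB1 R (y / x) (divr_gt0 y0 x0); rewrite ln_div ?posrE// => h.
  have := ler_wpM2l (ltW x0) h.
  have -> // : y - x = x * (y / x - 1) by field; rewrite gt_eqF.
have lnxy : ln x <= ln y by rewrite ler_ln ?posrE.
have lny : ln y <= 0 by exact: ln_le0.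
have lnd : (y - x) * ln (y - x) <= (y - x) * ln y.
  have [->|dN0] := eqVneq (y - x) 0; first by rewrite !mul0r.
  have dp : 0 < y - x by rewrite lt_def dN0.
  by rewrite ler_wpM2l// ler_ln ?posrE//; lra.
have := mulr_ln_ge d0.
have h1 : 0 <= x * (ln y - ln x) by apply: mulr_ge0; [exact: ltW|rewrite subr_ge0].
have h2 : (y - x) * ln y <= 0 by nra.
rewrite ler_norml; move=> h3; apply/andP; split; nra.
Qed.

(** The correction - p + q cancels when summed over two distributions; it makes the left side vanish
    to second order at p = q, so that a termwise comparison is possible. The bound 9 <= 2 ln M lets
    the same constant serve moderate ratios p / q <= 16. *)
Lemma kl_term_le (R : realType) (M p q : R) : 0 <= p -> 0 <= q -> p <= M * q ->
  9 <= 2 * ln M ->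
  p * ln (p / q) - p + q <= 2 * ln M * (Num.sqrt p - Num.sqrt q) ^+ 2.
Proof.
move=> p0 q0 pMq M9.
have [qE|qN0] := eqVneq q 0.
  have pE : p = 0 by apply/eqP; rewrite eq_le p0 andbT -(mulr0 M) -qE.
  by rewrite qE pE mul0r !subrr expr0n mulr0 addr0.
have {qN0}q0' : 0 < q by rewrite lt_def qN0.
have [->|pN0] := eqVneq p 0.
  by rewrite mul0r subr0 add0r sqrtr0 sub0r sqrrN sqr_sqrtr//; nra.
have {pN0}p0' : 0 < p by rewrite lt_def pN0.
have sp : 0 < Num.sqrt p by rewrite sqrtr_gt0.
have sq : 0 < Num.sqrt q by rewrite sqrtr_gt0.
have lnE : ln (p / q) = 2 * ln (Num.sqrt p / Num.sqrt q).
  rewrite -{1}(sqr_sqrtr p0) -{1}(sqr_sqrtr q0) -exprVn -exprMn lnXn ?divr_gt0//.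
  by rewrite mulr_natl.
(* For t = sqrt (p / q): if t <= 4 then ln t <= t - 1 bounds the left side by
   q (2 t + 1) (t - 1)^2 <= 9 q (t - 1)^2; if t > 4 then t^2 <= 2 (t - 1)^2. *)
have [le4|gt4] := leP (Num.sqrt p) (4 * Num.sqrt q).
  apply: (@le_trans _ _ (9 * (Num.sqrt p - Num.sqrt q) ^+ 2)); last first.
    by rewrite ler_wpM2r// sqr_ge0.
  rewrite lnE -{1 3}(sqr_sqrtr p0) -{2}(sqr_sqrtr q0).
  set s := Num.sqrt p in sp le4 *; set r := Num.sqrt q in sq le4 *.
  have sE : s = s / r * r by rewrite divfK// gt_eqF.
  have t0 : 0 < s / r by rewrite divr_gt0.
  have := ln_leB1 t0; set l := ln (s / r).
  move: t0 sE; set t := s / r => t0 sE hl.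
  have t4 : t <= 4 by rewrite /t ler_pdivrMr.
  rewrite sE.
  (* This product is exactly right side minus left side, because 2 t^3 - 3 t^2 + 1 = (2 t + 1) (t -
     1)^2. *)
  have : 0 <= r ^+ 2 * (2 * t ^+ 2 * (t - 1 - l) + (8 - 2 * t) * (t - 1) ^+ 2).
    by apply: mulr_ge0; [exact: sqr_ge0|apply: addr_ge0; apply: mulr_ge0;
      rewrite ?sqr_ge0//; try lra; rewrite mulr_ge0 ?sqr_ge0].
  nra.
have M0 : 0 < M by rewrite -(pmulr_lgt0 _ q0'); lra.
have lnpq : ln (p / q) <= ln M.
  by rewrite ler_ln ?posrE ?divr_gt0// ler_pdivrMr.
have : p <= 2 * (Num.sqrt p - Num.sqrt q) ^+ 2.
  by rewrite -{1}(sqr_sqrtr p0); nra.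
have : q <= p.
  by rewrite -(sqr_sqrtr p0) -(sqr_sqrtr q0); nra.
have : p * ln (p / q) <= p * ln M by rewrite ler_wpM2l.
nra.
Qed.

(** With s = sqrt p and r = sqrt q, p ln (p / q) = 2 s^2 ln (s / r) >= 2 s^2 - 2 s r; adding - s^2 +
    r^2 completes the square (s - r)^2. *)
Lemma kl_term_ge (R : realType) (p q : R) : 0 <= p -> 0 <= q ->
  (q = 0 -> p = 0) ->
  (Num.sqrt p - Num.sqrt q) ^+ 2 <= p * ln (p / q) - p + q.
Proof.
move=> p0 q0 ac.
have [qE|qN0] := eqVneq q 0.
  by rewrite qE ac// mul0r !subrr expr0n addr0.
have {qN0}q0' : 0 < q by rewrite lt_def qN0.
have [->|pN0] := eqVneq p 0.
  by rewrite mul0r subr0 add0r sqrtr0 sub0r sqrrN sqr_sqrtr.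
have {pN0}p0' : 0 < p by rewrite lt_def pN0.
have sp : 0 < Num.sqrt p by rewrite sqrtr_gt0.
have sq : 0 < Num.sqrt q by rewrite sqrtr_gt0.
have lnE : ln (p / q) = 2 * ln (Num.sqrt p / Num.sqrt q).
  rewrite -{1}(sqr_sqrtr p0) -{1}(sqr_sqrtr q0) -exprVn -exprMn lnXn ?divr_gt0//.
  by rewrite mulr_natl.
have := ln_ge1BV (divr_gt0 sp sq); rewrite invf_div lnE.
have pE := sqr_sqrtr p0; have qE := sqr_sqrtr q0.
set s := Num.sqrt p in sp pE *; set r := Num.sqrt q in sq qE *.
move=> h; have := ler_wpM2l (sqr_ge0 s) h.
rewrite mulrBr mulr1.
have -> : s ^+ 2 * (r / s) = s * r by field; rewrite gt_eqF.
rewrite pE; nra.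
Qed.

(** * Real-valued KL divergence against squared Hellinger distance *)

Definition klR (R : realType) (X : finType) (P Q : X -> R) : R :=
  \sum_x P x * ln (P x / Q x).

(** Absolute continuity rules out the [+oo] branch, and where [P x = 0] the factor [P x] kills the
    term of [klR]. *)
Lemma kl_klR (R : realType) (X : finType) (P Q : X -> R) :
  (forall x, Q x = 0 -> P x = 0) -> kl P Q = (klR P Q)%:E.
Proof.
move=> ac; rewrite /kl /klR -sumEFin; apply: eq_bigr => x _.
case: eqP => [->|/eqP PN0]; first by rewrite mul0r.
by case: eqP => // /ac /eqP; rewrite (negPf PN0).
Qed.

Lemma klR_le_hellinger2 (R : realType) (X : finType) (M : R) (P Q : X -> R) :
  is_dist P -> is_dist Q -> (forall x, P x <= M * Q x) -> 9 <= 2 * ln M ->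
  klR P Q <= 4 * ln M * hellinger2 P Q.
Proof.
move=> [P0 P1] [Q0 Q1] PMQ M9.
(* Both total masses are 1, so the added corrections sum to 0. *)
have -> : klR P Q = \sum_x (P x * ln (P x / Q x) - P x + Q x).
  by rewrite !big_split /= sumrN P1 Q1 subrK.
have -> : 4 * ln M * hellinger2 P Q =
    \sum_x 2 * ln M * (Num.sqrt (P x) - Num.sqrt (Q x)) ^+ 2.
  by rewrite /hellinger2 -mulr_sumr; set S := \sum_x _; field.
by apply: ler_sum => x _; exact: kl_term_le.
Qed.

(** Serves to show that mutual information is nonnegative and vanishes only for product laws. *)
Lemma hellinger2_le_klR (R : realType) (X : finType) (P Q : X -> R) :
  is_dist P -> is_dist Q -> (forall x, Q x = 0 -> P x = 0) ->
  2 * hellinger2 P Q <= klR P Q.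
Proof.
move=> [P0 P1] [Q0 Q1] ac.
have -> : klR P Q = \sum_x (P x * ln (P x / Q x) - P x + Q x).
  by rewrite !big_split /= sumrN P1 Q1 subrK.
rewrite /hellinger2 mulrA divff// mul1r.
by apply: ler_sum => x _; exact: kl_term_ge (P0 x) (Q0 x) (ac x).
Qed.

Lemma hellinger2_ge0 (R : realType) (X : finType) (P Q : X -> R) :
  0 <= hellinger2 P Q.
Proof. by rewrite mulr_ge0 ?invr_ge0 ?sumr_ge0// => x _; exact: sqr_ge0. Qed.

Lemma hellinger2_eqfun (R : realType) (X : finType) (P Q : X -> R) :
  P =1 Q -> hellinger2 P Q = 0.
Proof.
move=> PQ; rewrite /hellinger2 big1 ?mulr0// => x _.
by rewrite PQ subrr expr0n.
Qed.

Lemma hellinger2_eq0 (R : realType) (X : finType) (P Q : X -> R) :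
  (forall x, 0 <= P x) -> (forall x, 0 <= Q x) -> hellinger2 P Q = 0 -> P =1 Q.
Proof.
move=> P0 Q0 /eqP; rewrite mulf_eq0 invr_eq0 (pnatr_eq0 R 2) /= => /eqP h x.
have /(_ x isT)/eqP := psumr_eq0P (fun x _ => sqr_ge0 _) h.
rewrite sqrf_eq0 subr_eq0 => /eqP e.
by rewrite -(sqr_sqrtr (P0 x)) e sqr_sqrtr.
Qed.

Lemma dist_le1 (R : realType) (X : finType) (P : X -> R) x : is_dist P -> P x <= 1.
Proof.
by move=> [P0 <-]; rewrite (bigD1 x)//= lerDl sumr_ge0.
Qed.

(** * Distributions pushed through Markov kernels *)

Definition push (R : realType) (X Y : finType) (K : X -> Y -> R) (P : X -> R)
  (y : Y) : R := \sum_x P x * K x y.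

Lemma push_dist (R : realType) (X Y : finType) (K : X -> Y -> R) (P : X -> R) :
  is_kernel K -> is_dist P -> is_dist (push K P).
Proof.
move=> kK [P0 P1]; split=> [y|].
  by apply: sumr_ge0 => x _; rewrite mulr_ge0//; case: (kK x).
rewrite exchange_big/= -[RHS]P1; apply: eq_bigr => x _.
by rewrite -mulr_sumr; case: (kK x) => _ ->; rewrite mulr1.
Qed.

Lemma push_ge (R : realType) (X Y : finType) (K : X -> Y -> R) (P : X -> R) k y :
  is_dist P -> (forall x, k <= K x y) -> k <= push K P y.
Proof.
move=> [P0 P1] kK; rewrite -[k]mul1r -P1 mulr_suml.
by apply: ler_sum => x _; rewrite ler_wpM2l.
Qed.

(* Off the diagonal the rows of K have mass at most delta, so K neither removes
   nor adds more than delta at y. *)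
Lemma push_near (R : realType) (X : finType) (K : X -> X -> R) (P : X -> R) delta y :
  is_kernel K -> is_dist P -> (forall x, 1 - delta <= K x x) ->
  `|push K P y - P y| <= delta.
Proof.
move=> kK dP KD; have [P0 P1] := dP.
have Py1 := dist_le1 y dP.
have K1 x x' : K x x' <= 1 by exact: dist_le1.
have d0 : 0 <= delta by have := K1 y y; have := KD y; lra.
have Py0 := P0 y; have Dy := KD y; have Ky1 := K1 y y.
rewrite /push (bigD1 y)//=.
have S0 : 0 <= \sum_(x | x != y) P x * K x y.
  by apply: sumr_ge0 => x _; rewrite mulr_ge0//; case: (kK x).
have S1 : \sum_(x | x != y) P x * K x y <= (1 - P y) * delta.
  have -> : 1 - P y = \sum_(x | x != y) P x.
    by rewrite -P1 (bigD1 y)//= addrC addrK.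
  rewrite mulr_suml; apply: ler_sum => x xy; rewrite ler_wpM2l//.
  have [K0] := kK x; rewrite (bigD1 x)//= (bigD1 y) 1?eq_sym//= => KS.
  have : 0 <= \sum_(i | (i != x) && (i != y)) K x i by exact: sumr_ge0.
  have := KD x; lra.
rewrite ler_norml; apply/andP; split; nra.
Qed.

(** * Marginals, product of marginals and mutual information *)

Section Marginals.
Context (R : realType) (A C : finType) (p : A * C -> R).

Lemma sum_pairE (F : A * C -> R) : \sum_x F x = \sum_a \sum_c F (a, c).
Proof. by rewrite pair_bigA /=; apply: eq_bigr => -[]. Qed.

Hypothesis dp : is_dist p.

Lemma fst_marginal_dist : is_dist (fst_marginal p).
Proof.
have [p0 p1] := dp; split=> [a|]; first by apply: sumr_ge0 => c _; exact: p0.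
by rewrite -[RHS]p1 sum_pairE.
Qed.

Lemma snd_marginal_dist : is_dist (snd_marginal p).
Proof.
have [p0 p1] := dp; split=> [a|]; first by apply: sumr_ge0 => c _; exact: p0.
by rewrite -[RHS]p1 sum_pairE exchange_big.
Qed.

Lemma le_fst_marginal a c : p (a, c) <= fst_marginal p a.
Proof.
have [p0 _] := dp.
by rewrite /fst_marginal (bigD1 c)//= lerDl sumr_ge0.
Qed.

Lemma le_snd_marginal a c : p (a, c) <= snd_marginal p c.
Proof.
have [p0 _] := dp.
by rewrite /snd_marginal (bigD1 a)//= lerDl sumr_ge0.
Qed.

Lemma indep_product_dist : is_dist (indep_product p).
Proof.
have [a0 a1] := fst_marginal_dist; have [c0 c1] := snd_marginal_dist.
split=> [[a c]|]; first by rewrite mulr_ge0.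
rewrite sum_pairE -[RHS]a1; apply: eq_bigr => a _.
by rewrite /indep_product/= -mulr_sumr c1 mulr1.
Qed.

Lemma indep_product_ac x : indep_product p x = 0 -> p x = 0.
Proof.
case: x => a c; have [p0 _] := dp.
move=> /eqP; rewrite mulf_eq0 => /orP[] /eqP /= h; apply/eqP; rewrite eq_le p0 andbT.
  by rewrite -[leRHS]h le_fst_marginal.
by rewrite -[leRHS]h le_snd_marginal.
Qed.

Lemma klR_indep_ge0 : 0 <= klR p (indep_product p).
Proof.
apply: le_trans (hellinger2_le_klR dp indep_product_dist indep_product_ac).
by rewrite mulr_ge0 ?hellinger2_ge0.
Qed.

Lemma klR_indep_eq0 : klR p (indep_product p) = 0 -> p =1 indep_product p.
Proof.
move=> h; have := hellinger2_le_klR dp indep_product_dist indep_product_ac.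
rewrite h => h'; have [p0 _] := dp; have [q0 _] := indep_product_dist.
apply: hellinger2_eq0 => //; apply/eqP; rewrite eq_le hellinger2_ge0 andbT; lra.
Qed.

(** This is I(A:C) = H(A) + H(C) - H(A,C). Where p(a,c) > 0 both marginals are positive, so the
    logarithm of the ratio splits into three. *)
Lemma klR_indepE : klR p (indep_product p) = \sum_x p x * ln (p x)
  - \sum_a fst_marginal p a * ln (fst_marginal p a)
  - \sum_c snd_marginal p c * ln (snd_marginal p c).
Proof.
have -> : \sum_a fst_marginal p a * ln (fst_marginal p a) =
    \sum_x p x * ln (fst_marginal p x.1).
  by rewrite sum_pairE; apply: eq_bigr => a _; rewrite mulr_suml.
have -> : \sum_c snd_marginal p c * ln (snd_marginal p c) =
    \sum_x p x * ln (snd_marginal p x.2).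
  by rewrite sum_pairE exchange_big; apply: eq_bigr => a _; rewrite mulr_suml.
rewrite -!sumrB; apply: eq_bigr => -[a c] _ /=.
have [->|pN0] := eqVneq (p (a, c)) 0; first by rewrite !mul0r !subr0.
have [p0 _] := dp; have {pN0}pgt0 : 0 < p (a, c) by rewrite lt_def pN0 p0.
have pa := lt_le_trans pgt0 (le_fst_marginal a c).
have pc := lt_le_trans pgt0 (le_snd_marginal a c).
by rewrite /indep_product/= ln_div ?lnM ?posrE ?mulr_gt0//; ring.
Qed.

End Marginals.

(** * Noise on a single coordinate *)

Section ReplaceUnif.
Context (R : realType) (eta : R) (X : finType).
Hypothesis eta01 : 0 < eta < 1.
Let r : X -> X -> R := @replace_unif R eta X.

Lemma card_gt0R (x : X) : 0 < #|X|%:R :> R.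
Proof. by rewrite ltr0n; apply/card_gt0P; exists x. Qed.

(** The uniform part alone contributes this floor; it later keeps the noisy marginals away from
    0. *)
Lemma replace_unif_ge x y : eta / #|X|%:R <= r x y.
Proof.
have /andP[e0 e1] := eta01; rewrite /r /replace_unif lerDr.
by rewrite mulr_ge0// subr_ge0 ltW.
Qed.

Lemma replace_unif_diag x : 1 - eta <= r x x.
Proof.
have /andP[e0 e1] := eta01; rewrite /r /replace_unif eqxx mulr1 lerDl.
by rewrite divr_ge0// ltW.
Qed.

Lemma replace_unif_kernel : is_kernel r.
Proof.
move=> x; have /andP[e0 e1] := eta01; have X0 := card_gt0R x.
split=> [y|].
  by apply: le_trans (replace_unif_ge _ _); rewrite divr_ge0// ltW.
rewrite big_split/= -mulr_sumr (bigD1 x)//= eqxx big1 => [|y /negPf ->//].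
rewrite addr0 mulr1 sumr_const -mulrnAr -mulr_natl divff ?mulr1 ?subrK//.
by rewrite gt_eqF.
Qed.

End ReplaceUnif.

(** * Independent noise on both coordinates of a pair *)

Definition noise_pair (R : realType) (eta : R) (A C : finType) (x y : A * C) : R :=
  replace_unif eta x.1 y.1 * replace_unif eta x.2 y.2.

Section NoisePair.
Context (R : realType) (eta : R) (A C : finType).
Hypothesis eta01 : 0 < eta < 1.
Let K : A * C -> A * C -> R := @noise_pair R eta A C.

Lemma noise_pair_kernel : is_kernel K.
Proof.
move=> [a c]; have [a0 a1] := replace_unif_kernel eta01 a.
have [c0 c1] := replace_unif_kernel eta01 c; split=> [[a' c']|].
  by rewrite mulr_ge0.
rewrite sum_pairE -[RHS]a1; apply: eq_bigr => a' _.
by rewrite /K /noise_pair/= -mulr_sumr c1 mulr1.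
Qed.

(** Each coordinate survives with probability at least 1 - eta, and (1 - eta)^2 >= 1 - 2 eta. *)
Lemma noise_pair_diag x : 1 - 2 * eta <= K x x.
Proof.
have /andP[e0 e1] := eta01; case: x => a c; rewrite /K /noise_pair/=.
have := replace_unif_diag eta01 a; have := replace_unif_diag eta01 c.
by nra.
Qed.

Variable p : A * C -> R.

Lemma push_noise_pairE a' c' : push K p (a', c') =
  \sum_a \sum_c p (a, c) * (replace_unif eta a a' * replace_unif eta c c').
Proof. by rewrite /push sum_pairE. Qed.

(** The row of the noise on c sums to 1 and drops out, so a marginal feels only its own noise and
    moves by eta instead of 2 eta. *)
Lemma fst_marginal_push :
  fst_marginal (push K p) =1 push (@replace_unif R eta A) (fst_marginal p).
Proof.
move=> a'; rewrite /fst_marginal; under eq_bigr do rewrite push_noise_pairE.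
rewrite exchange_big; apply: eq_bigr => a _.
rewrite exchange_big mulr_suml; apply: eq_bigr => c _.
rewrite -mulr_sumr -mulr_sumr; have [_ ->] := replace_unif_kernel eta01 c.
by rewrite mulr1.
Qed.

Lemma snd_marginal_push :
  snd_marginal (push K p) =1 push (@replace_unif R eta C) (snd_marginal p).
Proof.
move=> c'; rewrite /snd_marginal; under eq_bigr do rewrite push_noise_pairE exchange_big.
rewrite exchange_big; apply: eq_bigr => c _.
rewrite exchange_big mulr_suml; apply: eq_bigr => a _.
rewrite -mulr_sumr -mulr_suml; have [_ ->] := replace_unif_kernel eta01 a.
by rewrite mul1r.
Qed.

Lemma push_indep : p =1 indep_product p -> push K p =1 indep_product (push K p).
Proof.
move=> ip [a' c']; rewrite /indep_product/= fst_marginal_push snd_marginal_push.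
rewrite push_noise_pairE /push mulr_suml; apply: eq_bigr => a _.
rewrite mulr_sumr; apply: eq_bigr => c _.
by rewrite ip /indep_product/=; ring.
Qed.

Hypothesis dp : is_dist p.
Let d : R := (#|A| * #|C|)%:R.

Lemma hellinger2_push_indep : klR p (indep_product p) = 0 ->
  hellinger2 (push K p) (indep_product (push K p)) = 0.
Proof.
by move=> h; apply: hellinger2_eqfun; apply: push_indep; exact: klR_indep_eq0.
Qed.

(** Each noisy marginal is an average of kernel entries, all at least eta over the alphabet size. *)
Lemma indep_product_push_ge x : eta ^+ 2 / d <= indep_product (push K p) x.
Proof.
have /andP[e0 e1] := eta01.
rewrite /indep_product fst_marginal_push snd_marginal_push.
have -> : eta ^+ 2 / d = (eta / #|A|%:R) * (eta / #|C|%:R).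
  by rewrite /d natrM invfM; ring.
by apply: ler_pM; rewrite ?divr_ge0 ?(ltW e0)//; apply: push_ge;
  [exact: fst_marginal_dist| |exact: snd_marginal_dist|] => ?;
  exact: replace_unif_ge.
Qed.

Lemma sum_mulr_ln_dist (X : finType) (P Q : X -> R) delta :
  is_dist P -> is_dist Q -> (forall x, `|P x - Q x| <= delta) ->
  `|\sum_x P x * ln (P x) - \sum_x Q x * ln (Q x)|
     <= #|X|%:R * (2 * Num.sqrt delta).
Proof.
move=> dP dQ PQ; rewrite -sumrB; apply: le_trans (ler_norm_sum _ _ _) _.
rewrite mulr_natl -sumr_const; apply: ler_sum => x _.
have [P0 _] := dP; have [Q0 _] := dQ.
apply: le_trans (mulr_ln_dist _ _) _; rewrite ?P0 ?Q0 ?dist_le1//.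
by rewrite ler_pM2l// ler_wsqrtr.
Qed.

(** The joint entropy changes by at most 2 d sqrt (2 eta) <= 4 d sqrt eta and each marginal entropy
    by at most 2 d sqrt eta, hence 8 d sqrt eta in all. *)
Lemma klR_push_ge : klR p (indep_product p) - 8 * d * Num.sqrt eta <=
  klR (push K p) (indep_product (push K p)).
Proof.
have /andP[e0 e1] := eta01.
have dp' := push_dist noise_pair_kernel dp.
rewrite !klR_indepE//.
have := sum_mulr_ln_dist dp' dp (fun y => push_near y noise_pair_kernel dp noise_pair_diag).
have rnear (X : finType) (P : X -> R) (dP : is_dist P) y := push_near y
  (@replace_unif_kernel _ _ X eta01) dP (replace_unif_diag eta01).
have hA : forall a, `|fst_marginal (push K p) a - fst_marginal p a| <= eta.
  by move=> a; rewrite fst_marginal_push; apply: rnear; exact: fst_marginal_dist.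
have hC : forall c, `|snd_marginal (push K p) c - snd_marginal p c| <= eta.
  by move=> c; rewrite snd_marginal_push; apply: rnear; exact: snd_marginal_dist.
have := sum_mulr_ln_dist (fst_marginal_dist dp') (fst_marginal_dist dp) hA.
have := sum_mulr_ln_dist (snd_marginal_dist dp') (snd_marginal_dist dp) hC.
set SC := \sum_c _; set SC' := \sum_c _; set SA := \sum_c _; set SA' := \sum_c _.
set S := \sum_c _; set S' := \sum_c _.
(* Total mass 1 makes both alphabets nonempty, which gives #|A| <= d and #|C| <= d. *)
have [x _] : exists x : A * C, true.
  apply/existsP; apply: contraT; rewrite negb_exists => /forallP h.
  by have [_] := dp; rewrite big1 => [/eqP|y _]; [rewrite eq_sym oner_eq0|have := h y].
case: x => a c.
have A1 : 1 <= #|A|%:R :> R by rewrite ler1n; apply/card_gt0P; exists a.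
have C1 : 1 <= #|C|%:R :> R by rewrite ler1n; apply/card_gt0P; exists c.
have cE : #|{: A * C}|%:R = d by rewrite card_prod.
have dA : #|A|%:R <= d by rewrite /d natrM; nra.
have dC : #|C|%:R <= d by rewrite /d natrM; nra.
rewrite cE; have s0 := sqrtr_ge0 eta.
have s2 : Num.sqrt (2 * eta) <= 2 * Num.sqrt eta.
  rewrite -[leRHS]ger0_norm ?mulr_ge0// -sqrtr_sqr ler_wsqrtr//.
  by rewrite exprMn sqr_sqrtr ?ltW//; lra.
rewrite !ler_norml => /andP[_ h1] /andP[_ h2] /andP[h3 _].
have : d * Num.sqrt (2 * eta) <= d * (2 * Num.sqrt eta).
  by rewrite ler_wpM2l.
have : #|A|%:R * Num.sqrt eta <= d * Num.sqrt eta by rewrite ler_wpM2r.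
have : #|C|%:R * Num.sqrt eta <= d * Num.sqrt eta by rewrite ler_wpM2r.
lra.
Qed.

Lemma hellinger2_push_ge : 9 <= 2 * ln (d / eta ^+ 2) ->
  klR p (indep_product p) - 8 * d * Num.sqrt eta <=
  4 * ln (d / eta ^+ 2) * hellinger2 (push K p) (indep_product (push K p)).
Proof.
move=> M9; have /andP[e0 e1] := eta01.
have dp' := push_dist noise_pair_kernel dp.
apply: le_trans klR_push_ge _; apply: klR_le_hellinger2 => //.
  exact: indep_product_dist.
(* The ratio bound with M = d / eta^2: a noisy entry is at most 1, and 1 is at most M times the
   product of noisy marginals. *)
move=> x; apply: le_trans (dist_le1 x dp') _.
have d0 : 0 < d by case: x => a c; rewrite /d natrM mulr_gt0// ?(card_gt0R R a) ?(card_gt0R R c).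
have M0 : 0 < d / eta ^+ 2 by rewrite divr_gt0// exprn_gt0.
rewrite -[X in X <= _](@divff _ (d / eta ^+ 2)) ?gt_eqF//.
by rewrite ler_pM2l// invf_div indep_product_push_ge.
Qed.

End NoisePair.

(** * Testers applied after a samplewise kernel *)

Section Testers.
Context (R : realType).

Lemma sum_tuple_prod (X : finType) (N : nat) (F : 'I_N -> X -> R) :
  \sum_(s : N.-tuple X) \prod_(i < N) F i (tnth s i) = \prod_(i < N) \sum_x F i x.
Proof.
rewrite bigA_distr_bigA (reindex (@tuple_of_finfun X N)).
  by apply: eq_bigr => f _; apply: eq_bigr => i _; rewrite tnth_mktuple.
by exists (@finfun_of_tuple X N) => ? _; [exact: tuple_of_finfunK|exact: finfun_of_tupleK].
Qed.

Lemma kernel_comp_tensor_kernel (X Y : finType) N (K : X -> Y -> R)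
    (T : N.-tuple Y -> bool -> R) :
  is_kernel K -> is_kernel T -> is_kernel (kernel_comp (kernel_tensor K) T).
Proof.
move=> kK kT s; split=> [b|].
  apply: sumr_ge0 => t _; rewrite mulr_ge0//; last by case: (kT t).
  by apply: prodr_ge0 => i _; case: (kK (tnth s i)).
rewrite exchange_big/=.
under eq_bigr => t _ do rewrite -mulr_sumr (proj2 (kT t)) mulr1.
rewrite (sum_tuple_prod (fun i => K (tnth s i))) big1// => i _.
by case: (kK (tnth s i)).
Qed.

(** Independent samples of P, each sent through K, are independent samples of [push K P]: after
    swapping sums, the sum over input tuples factors by coordinate. *)
Lemma output_prob_push (X Y : finType) N (K : X -> Y -> R) (P : X -> R)
    (T : N.-tuple Y -> bool -> R) b :
  output_prob P (kernel_comp (kernel_tensor K) T) b = output_prob (push K P) T b.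
Proof.
rewrite /output_prob; under eq_bigr do rewrite mulr_sumr.
rewrite exchange_big; apply: eq_bigr => t _.
under eq_bigr do rewrite mulrA; rewrite -mulr_suml; congr (_ * _).
under eq_bigr do rewrite -big_split.
exact: (sum_tuple_prod (fun i x => P x * K x (tnth t i))).
Qed.

Lemma distinguishes_push (X Y : finType) N (K : X -> Y -> R)
    (H0 H1 : (X -> R) -> Prop) (H0' H1' : (Y -> R) -> Prop)
    (T : N.-tuple Y -> bool -> R) :
  is_kernel K ->
  (forall P, is_dist P -> H0 P -> H0' (push K P)) ->
  (forall P, is_dist P -> H1 P -> H1' (push K P)) ->
  distinguishes H0' H1' T ->
  distinguishes H0 H1 (kernel_comp (kernel_tensor K) T).
Proof.
move=> kK h0 h1 [kT t0 t1]; split; first exact: kernel_comp_tensor_kernel.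
- move=> P dP HP; rewrite output_prob_push; apply: t0; last exact: h0.
  exact: push_dist.
- move=> P dP HP; rewrite output_prob_push; apply: t1; last exact: h1.
  exact: push_dist.
Qed.

(** The reduction keeps N, so the achievable sample sizes are nested and the infima compare in the
    reverse order. *)
Lemma sample_complexity_le (X Y : finType)
    (S : forall N, (N.-tuple X -> bool -> R) -> Prop)
    (S' : forall N, (N.-tuple Y -> bool -> R) -> Prop) :
  (forall N T', S' N T' -> exists T, S N T) ->
  (sample_complexity S <= sample_complexity S')%E.
Proof.
move=> h; apply: ereal_inf_le_tmp => _ [N [T' ST'] <-].
by exists N => //; exact: h ST'.
Qed.

End Testers.

(** * Decomposition over the values of b *)

Definition slice_mass (R : realType) (A B C : finType) (P : A * B * C -> R) (b : B) : R :=
  fst_marginal (marginal_BC P) b.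

(* The conditional distribution on A x C given b; identically 0 if b has mass 0. *)
Definition slice (R : realType) (A B C : finType) (P : A * B * C -> R) (b : B)
  (x : A * C) : R := P (x.1, b, x.2) / slice_mass P b.

Section Slices.
Context (R : realType) (A B C : finType).
Implicit Type P : A * B * C -> R.

Lemma sum_slice (F : A * B * C -> R) :
  \sum_x F x = \sum_b \sum_(y : A * C) F (y.1, b, y.2).
Proof.
rewrite sum_pairE (sum_pairE (fun ab => \sum_c F (ab, c))) exchange_big.
by apply: eq_bigr => b _; rewrite sum_pairE.
Qed.

Lemma slice_massE P b : slice_mass P b = \sum_(y : A * C) P (y.1, b, y.2).
Proof. by rewrite sum_pairE /= exchange_big. Qed.

Section Distribution.
Variable P : A * B * C -> R.
Hypothesis dP : is_dist P.

Lemma slice_mass_dist : is_dist (slice_mass P).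
Proof.
have [P0 P1] := dP; split=> [b|].
  by rewrite slice_massE; apply: sumr_ge0 => y _; exact: P0.
by rewrite -[RHS]P1 sum_slice; apply: eq_bigr => b _; rewrite slice_massE.
Qed.

Lemma slice_dist b : slice_mass P b != 0 -> is_dist (slice P b).
Proof.
move=> m0; have [P0 _] := dP; have [mge0 _] := slice_mass_dist.
by split=> [y|]; [rewrite divr_ge0|rewrite -mulr_suml -slice_massE divff].
Qed.

(** If b has mass 0, its nonnegative entries sum to 0 and all vanish, so the factorization holds for
    every b. *)
Lemma mass_slice a b c : P (a, b, c) = slice_mass P b * slice P b (a, c).
Proof.
have [m0|m0] := eqVneq (slice_mass P b) 0; last by rewrite /slice mulrC divfK.
have [P0 _] := dP; rewrite m0 mul0r.
move/eqP: m0; rewrite slice_massE => /eqP/psumr_eq0P h.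
by apply: (h (fun y _ => P0 _) (a, c)).
Qed.

Lemma markov_product_slice a b c :
  markov_product P (a, b, c) = slice_mass P b * indep_product (slice P b) (a, c).
Proof.
rewrite /markov_product /cond_C_B -/(slice_mass P b) /indep_product /=.
have -> : fst_marginal (slice P b) a = fst_marginal P (a, b) / slice_mass P b.
  by rewrite /fst_marginal mulr_suml.
have -> : snd_marginal (slice P b) c = marginal_BC P (b, c) / slice_mass P b.
  by rewrite /snd_marginal /slice -mulr_suml.
have [->|m0] := eqVneq (slice_mass P b) 0; first by rewrite invr0 mul0r !mulr0.
by field.
Qed.

(** The mass of b cancels in the likelihood ratio and stays only as a weight. The value is finite,
    since the Markov product vanishes only where P does. *)
Lemma cond_mutual_info_slice : cond_mutual_info P =
  (\sum_b slice_mass P b * klR (slice P b) (indep_product (slice P b)))%:E.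
Proof.
rewrite /cond_mutual_info kl_klR.
  rewrite /klR sum_slice; congr EFin; apply: eq_bigr => b _.
  rewrite mulr_sumr; apply: eq_bigr => -[a c] _ /=.
  rewrite mass_slice markov_product_slice.
  have [->|m0] := eqVneq (slice_mass P b) 0; first by rewrite !mul0r.
  by rewrite -mulf_div divff// mul1r mulrA.
move=> [[a b] c]; rewrite mass_slice markov_product_slice => /eqP.
have [->|m0] := eqVneq (slice_mass P b) 0; first by rewrite !mul0r.
rewrite mulf_eq0 (negPf m0)/= => /eqP h.
by rewrite (indep_product_ac (slice_dist m0) h) mulr0.
Qed.

(** Both square roots contain the factor sqrt of the mass of b, which leaves the square as the mass
    itself. *)
Lemma hellinger2_markov_slice : hellinger2 P (markov_product P) =
  \sum_b slice_mass P b * hellinger2 (slice P b) (indep_product (slice P b)).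
Proof.
have [mge0 _] := slice_mass_dist.
rewrite /hellinger2 sum_slice mulr_sumr; apply: eq_bigr => b _.
rewrite mulrCA; congr (_ * _); rewrite mulr_sumr; apply: eq_bigr => -[a c] _ /=.
rewrite mass_slice markov_product_slice !(sqrtrM _ (mge0 b)) -mulrBr exprMn sqr_sqrtr//.
Qed.

End Distribution.

Variable eta : R.
Hypothesis eta01 : 0 < eta < 1.
Let K : A * B * C -> A * B * C -> R := @noise_kernel R eta A B C.

Lemma noise_kernelE a b c a' b' c' : K (a, b, c) (a', b', c') =
  (b' == b)%:R * noise_pair eta (a, c) (a', c').
Proof. by rewrite /K /noise_kernel /noise_pair /=; ring. Qed.

Lemma noise_kernel_kernel : is_kernel K.
Proof.
move=> [[a b] c]; have [n0 n1] := noise_pair_kernel eta01 (a, c); split.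
  by move=> [[a' b'] c']; rewrite noise_kernelE mulr_ge0.
rewrite sum_slice (bigD1 b)//= [X in _ + X]big1 => [|b' /negPf bb']; last first.
  by apply: big1 => y _; rewrite noise_kernelE bb' mul0r.
rewrite addr0 -[RHS]n1; apply: eq_bigr => -[a' c'] _.
by rewrite noise_kernelE eqxx mul1r.
Qed.

Lemma push_noise_kernelE P a' b' c' : push K P (a', b', c') =
  \sum_(y : A * C) P (y.1, b', y.2) * noise_pair eta y (a', c').
Proof.
rewrite /push sum_slice (bigD1 b')//= [X in _ + X]big1 => [|b bb']; last first.
  apply: big1 => y _; rewrite noise_kernelE.
  by rewrite eq_sym (negPf bb') mul0r mulr0.
by rewrite addr0; apply: eq_bigr => -[a c] _; rewrite noise_kernelE eqxx mul1r.
Qed.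

Lemma slice_mass_push P : slice_mass (push K P) =1 slice_mass P.
Proof.
move=> b; rewrite !slice_massE; under eq_bigr do rewrite push_noise_kernelE.
rewrite exchange_big; apply: eq_bigr => y _.
rewrite -mulr_sumr; under eq_bigr do rewrite -surjective_pairing.
by have [_ ->] := noise_pair_kernel eta01 y; rewrite mulr1.
Qed.

(** The noise keeps b, so the normalizing mass is unchanged and linearity suffices. A b of mass 0 is
    covered too: both sides are then 0. *)
Lemma slice_push P b : slice (push K P) b = push (@noise_pair R eta A C) (slice P b).
Proof.
apply: funext => -[a c]; rewrite /slice /= slice_mass_push push_noise_kernelE.
by rewrite /push mulr_suml; apply: eq_bigr => y _; rewrite mulrAC.
Qed.

(** A zero average of nonnegative mutual informations forces every slice of positive mass to be
    independent, and the noise keeps it so. *)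
Lemma hellinger2_push_markov P : is_dist P -> cond_mutual_info P = 0%E ->
  hellinger2 (push K P) (markov_product (push K P)) = 0.
Proof.
move=> dP; have dP' := push_dist noise_kernel_kernel dP.
have [m0 _] := slice_mass_dist dP.
rewrite cond_mutual_info_slice// hellinger2_markov_slice// => -[/psumr_eq0P h].
apply: big1 => b _; rewrite slice_push slice_mass_push.
have [->|mN0] := eqVneq (slice_mass P b) 0; first by rewrite mul0r.
rewrite hellinger2_push_indep ?mulr0//; first exact: slice_dist.
have /eqP : slice_mass P b * klR (slice P b) (indep_product (slice P b)) = 0.
  apply: h => // b' _.
  have [->|mN0'] := eqVneq (slice_mass P b') 0; first by rewrite mul0r.
  by rewrite mulr_ge0// klR_indep_ge0//; exact: slice_dist.
by rewrite mulf_eq0 (negPf mN0) => /eqP.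
Qed.

(** The loss per slice does not depend on b and the masses sum to 1, so averaging costs it only once
    and the size of B does not enter. *)
Lemma hellinger2_push_markov_ge (d := (#|A| * #|C|)%:R : R) P (eps : R) :
  9 <= 2 * ln (d / eta ^+ 2) -> is_dist P -> (eps%:E <= cond_mutual_info P)%E ->
  eps - 8 * d * Num.sqrt eta <=
  4 * ln (d / eta ^+ 2) * hellinger2 (push K P) (markov_product (push K P)).
Proof.
move=> M9 dP; have dP' := push_dist noise_kernel_kernel dP.
have [m0 m1] := slice_mass_dist dP.
rewrite cond_mutual_info_slice// hellinger2_markov_slice// lee_fin => h.
apply: (@le_trans _ _ (\sum_b slice_mass P b *
  (klR (slice P b) (indep_product (slice P b)) - 8 * d * Num.sqrt eta))).
  under eq_bigr do rewrite mulrBr.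
  by rewrite sumrB -mulr_suml m1 mul1r lerB.
rewrite mulr_sumr; apply: ler_sum => b _; rewrite slice_push slice_mass_push.
have [->|mN0] := eqVneq (slice_mass P b) 0; first by rewrite !mul0r mulr0.
rewrite mulrCA ler_wpM2l// hellinger2_push_ge//; exact: slice_dist.
Qed.

End Slices.

Lemma mutual_info_klR (R : realType) (A C : finType) (p : A * C -> R) :
  is_dist p -> mutual_info p = (klR p (indep_product p))%:E.
Proof. by move=> dp; rewrite /mutual_info kl_klR// => x; exact: indep_product_ac. Qed.

(** * Choice of the noise level and the resulting threshold *)

Section Threshold.
Variable R : realType.

(** Solves 8 d sqrt eta = eps / 2 for d = dA dC. *)
Definition noise_level (eps : R) (dA dC : nat) : R :=
  (eps / (16 * (dA * dC)%:R)) ^+ 2.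

Lemma noise_level_polylog : eq_up_to_polylog noise_level
  (fun eps dA dC => eps ^+ 2 / (dA * dC)%:R ^+ 2).
Proof.
(* The two sides differ exactly by 16^2 = 256, with no logarithmic factor. *)
exists 256, 0%N; split=> // eps dA dC /andP[e0 e1] dA0 dC0.
rewrite /= expr0 mulr1 /noise_level expr_div_n exprMn invfM.
have := divr_ge0 (sqr_ge0 eps) (sqr_ge0 ((dA * dC)%:R : R)).
rewrite mulrCA; set x := _ / _ => x0.
have -> : (16 ^+ 2 : R) = 256 by rewrite -natrX.
by split; lra.
Qed.

Section FixedDimensions.
Variables (eps : R) (dA dC : nat).
Hypotheses (eps01 : 0 < eps < 1) (dA0 : (0 < dA)%N) (dC0 : (0 < dC)%N).
Let d : R := (dA * dC)%:R.
Let h := noise_level eps dA dC.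
Let nu := eps / (8 * ln (d / h ^+ 2)).

Let d1 : 1 <= d.
Proof. by rewrite /d ler1n muln_gt0 dA0. Qed.

Lemma sqrt_noise_level : Num.sqrt h = eps / (16 * d).
Proof.
by rewrite sqrtr_sqr ger0_norm// divr_ge0 ?mulr_ge0//; have /andP[/ltW] := eps01.
Qed.

Lemma noise_level_bounds : 0 < h <= 256^-1.
Proof.
have /andP[e0 e1] := eps01; have d0 : 0 < d by apply: lt_le_trans d1.
have x0 : 0 < eps / (16 * d) by rewrite divr_gt0// mulr_gt0.
rewrite exprn_gt0//=.
have x1 : eps / (16 * d) <= 16^-1.
  rewrite ler_pdivrMr ?mulr_gt0// mulKf ?pnatr_eq0//.
  by apply: ltW; apply: lt_le_trans e1 d1.
have -> : (256^-1 : R) = 16^-1 ^+ 2 by rewrite exprVn -natrX.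
by rewrite ler_sqr// nnegrE ltW.
Qed.

Lemma noise_level01 : 0 < h < 1.
Proof.
have /andP[-> h1] := noise_level_bounds.
by apply: le_lt_trans h1 _; rewrite invf_lt1 ?ltr1n.
Qed.

(** From h <= 2^-8 and d >= 1 the ratio is at least 2^16; with ln 2 >= 1/2 the right side is at
    least 16. *)
Lemma log_ratio_ge : 9 <= 2 * ln (d / h ^+ 2).
Proof.
have /andP[h0 h1] := noise_level_bounds.
have ln2 : (1 / 2 : R) <= ln 2 by have := @ln_ge1BV R 2 (ltr0n R 2); lra.
have : (2 : R) ^+ 16 <= d / h ^+ 2.
  have -> : (2 : R) ^+ 16 = (256^-1 ^+ 2)^-1 by rewrite exprVn invrK -!natrX.
  rewrite -[leLHS]mul1r; apply: ler_pM => //.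
  have h2 : 0 < h ^+ 2 := exprn_gt0 2 h0.
  have c2 : 0 < (256^-1 : R) ^+ 2 by rewrite exprn_gt0// invr_gt0.
  by rewrite lef_pV2 ?posrE//; apply: lerXn2r => //; rewrite nnegrE// ltW.
move=> hM; have M0 : 0 < d / h ^+ 2 by apply: lt_le_trans hM; rewrite exprn_gt0.
move: hM; rewrite -ler_ln ?posrE ?exprn_gt0// lnXn// -(mulr_natl (ln 2)); lra.
Qed.

(** The loss is eps / 2, so eps / 2 <= 4 L H with L the logarithm; dividing by 4 L > 0 gives the 8
    in [nu]. *)
Lemma hellinger2_threshold (H : R) :
  eps - 8 * d * Num.sqrt h <= 4 * ln (d / h ^+ 2) * H -> nu <= H.
Proof.
rewrite sqrt_noise_level => hH; have := log_ratio_ge; rewrite /nu.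
move: hH; set L := ln _ => hH L9; have d0 : 0 < d by apply: lt_le_trans d1.
rewrite ler_pdivrMr; last lra.
have : 8 * d * (eps / (16 * d)) = eps / 2 by move: d0; move: (d) => x x0; field; rewrite gt_eqF.
lra.
Qed.

Lemma cmi_tester_preprocessed (dB N : nat)
    (T : N.-tuple ('I_dA * 'I_dB * 'I_dC)%type -> bool -> R) :
  ci_hellinger_tester nu T -> cmi_tester eps (preprocessed h T).
Proof.
apply: distinguishes_push => [|P dP|P dP HP].
- exact: noise_kernel_kernel noise_level01.
- exact: hellinger2_push_markov noise_level01 _ dP.
- apply: hellinger2_threshold.
  have := @hellinger2_push_markov_ge R 'I_dA 'I_dB 'I_dC h noise_level01 P eps.
  by rewrite !card_ord; apply=> //; exact: log_ratio_ge.
Qed.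

Lemma mi_tester_preprocessed (N : nat)
    (T : N.-tuple ('I_dA * 'I_dC)%type -> bool -> R) :
  i_hellinger_tester nu T ->
  mi_tester eps (kernel_comp (kernel_tensor (@noise_pair R h 'I_dA 'I_dC)) T).
Proof.
apply: distinguishes_push => [|P dP|P dP].
- exact: noise_pair_kernel noise_level01.
- rewrite mutual_info_klR// => -[hP].
  exact: (hellinger2_push_indep noise_level01 dP hP).
- rewrite mutual_info_klR// lee_fin => HP; apply: hellinger2_threshold.
  have := @hellinger2_push_ge R h 'I_dA 'I_dC noise_level01 P dP.
  rewrite !card_ord => /(_ log_ratio_ge); apply: le_trans.
  by rewrite lerB.
Qed.

End FixedDimensions.
End Threshold.

Theorem theorem1 (R : realType) :
  exists (eta : R -> nat -> nat -> R) (C : R),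
    [/\ 0 < C,
        eq_up_to_polylog eta
          (fun eps dA dC => eps ^+ 2 / (dA * dC)%:R ^+ 2)
      & forall (eps : R) (dA dC : nat),
          0 < eps < 1 -> (0 < dA)%N -> (0 < dC)%N ->
          let h := eta eps dA dC in
          let nu := eps / (8 * ln ((dA * dC)%:R / h ^+ 2)) in
          [/\ 0 < h < 1,
              forall (dB N : nat)
                (T : N.-tuple ('I_dA * 'I_dB * 'I_dC)%type -> bool -> R),
                (0 < dB)%N ->
                ci_hellinger_tester nu T -> cmi_tester eps (preprocessed h T),
              forall dB : nat, (0 < dB)%N ->
                (SC_CMI eps dA dB dC <= C%:E * SC_CI_H nu dA dB dC)%E
            & (SC_MI eps dA dC <= C%:E * SC_I_H nu dA dC)%E]].
Proof.
(* The constant is 1 because preprocessing turns each sample into exactly one sample. *)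
exists (@noise_level R), 1; split=> //; first exact: noise_level_polylog.
move=> eps dA dC e01 dA0 dC0 h nu; rewrite !mul1e; split.
- exact: noise_level01.
- by move=> dB N T _; exact: cmi_tester_preprocessed.
- move=> dB _; rewrite mul1e; apply: sample_complexity_le => N T hT.
  by exists (preprocessed h T); exact: cmi_tester_preprocessed.
- apply: sample_complexity_le => N T hT; eexists.
  by apply: mi_tester_preprocessed hT.
Qed.
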